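(* Let $M\in[0,1]^{m\times n}$ with $\|M\|_*\le t$, let $\rho\in[0,1)$ and $\delta\in(0,1)$. Let $Y\in\{0,1\}^{m\times n}$ have independent entries with $P(Y_{ij}=1)=M_{ij}$, let $s$ be the number of ones in $Y$, and let $A\in\{0,1\}^{m\times n}$ be the observation matrix obtained by revealing each 1 of $Y$ independently with probability $1-\rho$ (so $P(A_{ij}=1)=M_{ij}(1-\rho)$, and $A_{ij}=0$ otherwise). Define $$\tilde{\ell}(x,a)=\begin{cases}\dfrac{(x-1)^2-\rho x^2}{1-\rho} & \text{if } a=1,\\[1mm] x^2 & \text{if } a=0,\end{cases}$$ and let $\hat{X}$ be a minimizer of $$\min_{X\in\mathbb{R}^{m\times n}}\sum_{i,j}\tilde{\ell}(X_{ij},A_{ij})\quad\text{subject to}\quad \|X\|_*\le t,\ 0\le X_{ij}\le 1\ \forall (i,j).$$ Then there is a constant $C$ such that, with probability at least $1-\delta$, $$\frac{1}{mn}\sum_{i,j}(M_{ij}-\hat{X}_{ij})^2\le 6\,\frac{\sqrt{\log(2/\delta)}}{\sqrt{mn}\,(1-\rho)}+2Ct\,\frac{\sqrt{n}+\sqrt{m}+\sqrt[4]{s}}{(1-\rho)mn}.$$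
   Context: $\|\cdot\|_*$ is the nuclear (trace) norm. The estimator $\hat{X}$ is the ''shifted matrix completion'' (ShiftMC) estimator for PU matrix completion in the non-deterministic setting, where only a fraction $1-\rho$ of the ones of the clean binary matrix $Y$ is observed. *)

(* Defs.v *)
From HB Require Import structures.
From mathcomp Require Import all_boot all_order all_algebra.
From mathcomp Require Import boolp classical_sets reals exp.
Set Implicit Arguments. Unset Strict Implicit. Unset Printing Implicit Defensive.
Import Order.TTheory GRing.Theory Num.Theory.
Local Open Scope ring_scope.

Definition psdmx (R : realType) n (P : 'M[R]_n) : Prop :=
  P^T = P /\ forall v : 'rV[R]_n, 0 <= (v *m P *m v^T) 0 0.

(* nuclear (trace) norm: ||X||_* = tr (sqrt (X^T X)), where sqrt(X^T X) is
   the unique PSD square root of X^T X (= sum of the singular values of X). *)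
Definition nucnorm (R : realType) m n (X : 'M[R]_(m, n)) : R :=
  \tr (xget (0 : 'M[R]_n) [set P | psdmx P /\ P *m P = X^T *m X]).

Definition pu_loss (R : realType) (rho x : R) (a : bool) : R :=
  if a then ((x - 1) ^+ 2 - rho * x ^+ 2) / (1 - rho) else x ^+ 2.

Definition pu_obj (R : realType) m n (rho : R) (A : 'M[bool]_(m, n))
  (X : 'M[R]_(m, n)) : R :=
  \sum_(i < m) \sum_(j < n) pu_loss rho (X i j) (A i j).

Definition feasible (R : realType) m n (t : R) (X : 'M[R]_(m, n)) : Prop :=
  nucnorm X <= t /\ forall i j, 0 <= X i j <= 1.

Definition shiftmc_minimizer (R : realType) m n (rho t : R)
  (A : 'M[bool]_(m, n)) (X : 'M[R]_(m, n)) : Prop :=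
  feasible t X /\ forall X', feasible t X' -> pu_obj rho A X <= pu_obj rho A X'.

(* joint law of one entry (Y_ij, A_ij): Y_ij ~ Bernoulli(M_ij), and A_ij = 1
   with prob. 1 - rho given Y_ij = 1, A_ij = 0 when Y_ij = 0 *)
Definition entry_pmf (R : realType) (rho p : R) (y a : bool) : R :=
  match y, a with
  | true, true => p * (1 - rho)
  | true, false => p * rho
  | false, false => 1 - p
  | false, true => 0
  end.

Definition joint_pmf (R : realType) m n (rho : R) (M : 'M[R]_(m, n))
  (w : 'M[bool]_(m, n) * 'M[bool]_(m, n)) : R :=
  \prod_(i < m) \prod_(j < n) entry_pmf rho (M i j) (w.1 i j) (w.2 i j).

Definition nones m n (Y : 'M[bool]_(m, n)) : nat :=
  (\sum_(i < m) \sum_(j < n) (Y i j : nat))%N.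

(* Main.v *)
(** The shifted loss is [u^2 - 2 u a / (1 - rho)] up to a term free of [u], so the
    estimator is a least squares fit of the unbiased surrogate [A / (1 - rho)] of
    [M].  Optimality against the feasible matrix [M] gives
    [|Xhat - M|^2 <= 2 <N, Xhat - M>] with [N = A / (1 - rho) - M] centred with
    independent entries.  Let [f] be the maximum of [<N, X - M>] over the possible
    outputs [X] of the estimator.  By McDiarmid's inequality [f] exceeds its mean by
    at most [sqrt (8 m n log (2 / delta)) / (1 - rho)] with probability at least
    [1 - delta].  Trace duality bounds the mean by [2 t] times the mean spectral norm
    of [N], which is [O ((sqrt m + sqrt n) / (1 - rho))]: the spectral norm is
    controlled by a net of integer vectors, and the maximum over the net by a
    log-sum-exp bound.  Since [N] is bounded, the nonnegative term [s^(1/4)] of the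
    theorem is not needed. *)

Require Import Defs.
From HB Require Import structures.
From mathcomp Require Import all_boot all_order all_algebra.
From mathcomp Require Import complex ring lra.
From mathcomp Require Import boolp classical_sets reals sequences exp.
Set Implicit Arguments. Unset Strict Implicit. Unset Printing Implicit Defensive.
Import Order.TTheory GRing.Theory Num.Theory.
Local Open Scope ring_scope.

(** * Spectral theorem and trace duality *)

Lemma sqnorm_ge0 (R : realDomainType) n (u : 'rV[R]_n) : 0 <= (u *m u^T) 0 0.
Proof.
by rewrite mxE sumr_ge0 // => i _; rewrite mxE -expr2 sqr_ge0.
Qed.

Lemma sqnorm_eq0 (R : realDomainType) n (u : 'rV[R]_n) :
  (u *m u^T) 0 0 = 0 -> u = 0.
Proof.
rewrite mxE => /eqP; rewrite psumr_eq0; last first.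
  by move=> i _; rewrite mxE -expr2 sqr_ge0.
move=> /allP u0; apply/rowP => i; rewrite mxE.
by have := u0 i (mem_index_enum i); rewrite /= mxE -expr2 sqrf_eq0 => /eqP.
Qed.

(** Split a complex eigenvector as [x + i y] with eigenvalue [a + i b]. Symmetry of [A] equates
    [x A y^T] with [y A x^T], which forces [b (|x|^2 + |y|^2) = 0]. Hence [b = 0], and whichever of
    [x], [y] is nonzero is a real eigenvector. *)
Lemma symmetric_eigenvector (R : rcfType) n (A : 'M[R]_n.+1) :
  A^T = A -> exists a (v : 'rV[R]_n.+1), v != 0 /\ v *m A = a *: v.
Proof.
move=> symA.
have [c /eigenvalueP[v vA v0]] :=
  @eigenvalue_closed R[i] _ (map_mx (real_complex R) A) (ltn0Sn n).
pose x := map_mx (@complex.Re R) v; pose y := map_mx (@complex.Im R) v.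
pose a := complex.Re c; pose b := complex.Im c.
have xA : x *m A = a *: x - b *: y.
  apply/rowP => j; have /rowP/(_ j) := vA.
  move=> /(congr1 (@complex.Re R)); rewrite !mxE raddf_sum /=.
  under eq_bigr do rewrite mxE.
  move=> H; under eq_bigr do rewrite mxE.
  move: H; rewrite /a /b; case: (c) => c1 c2 /=; case: (v 0 j) => v1 v2 /= <-.
  by apply: eq_bigr => k _; case: (v 0 k) => z1 z2 /=; rewrite mulr0 subr0.
have yA : y *m A = a *: y + b *: x.
  apply/rowP => j; have /rowP/(_ j) := vA.
  move=> /(congr1 (@complex.Im R)); rewrite !mxE raddf_sum /=.
  under eq_bigr do rewrite mxE.
  move=> H; under eq_bigr do rewrite mxE.
  move: H; rewrite /a /b; case: (c) => c1 c2 /=; case: (v 0 j) => v1 v2 /= <-.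
  by apply: eq_bigr => k _; case: (v 0 k) => z1 z2 /=; rewrite mulr0 add0r mulrC.
have symm : (x *m A *m y^T) 0 0 = (y *m A *m x^T) 0 0.
  have -> : y *m A *m x^T = (x *m A *m y^T)^T.
    by rewrite !trmx_mul trmxK symA mulmxA.
  by rewrite [RHS]mxE.
have symd : (y *m x^T) 0 0 = (x *m y^T) 0 0.
  have -> : y *m x^T = (x *m y^T)^T by rewrite trmx_mul trmxK.
  by rewrite [LHS]mxE.
have nz : x != 0 \/ y != 0.
  have [x0|] := eqVneq x 0; last by left.
  right; apply: contra_neq v0 => y0; apply/rowP => j.
  have /rowP/(_ j) := x0; have /rowP/(_ j) := y0; rewrite !mxE.
  by case: (v 0 j) => z1 z2 /= -> ->.
have b0 : b = 0.
  have {}symm : a * (x *m y^T) 0 0 - b * (y *m y^T) 0 0 =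
      a * (y *m x^T) 0 0 + b * (x *m x^T) 0 0.
    by move: symm; rewrite xA yA mulmxBl mulmxDl -!scalemxAl !mxE.
  have {}symm : b * ((x *m x^T) 0 0 + (y *m y^T) 0 0) = 0.
    move: symm; rewrite symd; lra.
  apply/eqP; move/eqP: symm; rewrite mulf_eq0 => /orP[//|].
  rewrite paddr_eq0 ?sqnorm_ge0 // => /andP[/eqP/sqnorm_eq0 x0 /eqP/sqnorm_eq0 y0].
  by case: nz; rewrite ?x0 ?y0 eqxx.
exists a; case: nz => nz; [exists x|exists y]; split=> //.
  by rewrite xA b0 scale0r subr0.
by rewrite yA b0 scale0r addr0.
Qed.

(** [H] is the Householder reflection along [w = u - e], where [u = v / |v|]; it exchanges [e] and
    [u]. If [u = e] then [w = 0] and the identity serves instead. *)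
Lemma reflection_first_row (R : rcfType) n (v : 'rV[R]_(1 + n)) : v != 0 ->
  exists H : 'M[R]_(1 + n), H *m H^T = 1%:M /\
    exists c, v = c *: (delta_mx 0 0 *m H).
Proof.
move=> v0; pose s := Num.sqrt ((v *m v^T) 0 0).
have s0 : s != 0.
  apply: contra_neq v0 => /eqP; rewrite sqrtr_eq0 => le0.
  by apply: sqnorm_eq0; apply/eqP; rewrite eq_le le0 sqnorm_ge0.
pose u := s^-1 *: v.
have vu : v = s *: u by rewrite scalerA divff // scale1r.
have uu : (u *m u^T) 0 0 = 1.
  rewrite /u linearZ /= -scalemxAl -scalemxAr !mxE.
  rewrite -[X in _ * (_ * X)](_ : s ^+ 2 = _); first by field.
  by rewrite sqr_sqrtr ?sqnorm_ge0 // mxE.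
pose e : 'rV[R]_(1 + n) := delta_mx 0 0.
have [ue|ue] := eqVneq u e.
  exists 1%:M; rewrite trmx1 mulmx1; split=> //; exists s.
  by rewrite mulmx1 {1}vu ue.
pose w := u - e.
have ww : (w *m w^T) 0 0 != 0.
  by apply: contra_neq ue => /sqnorm_eq0/eqP; rewrite subr_eq0 => /eqP.
have wwM : w *m w^T = ((w *m w^T) 0 0)%:M by rewrite [LHS]mx11_scalar.
pose k := 2 / (w *m w^T) 0 0.
pose H := 1%:M - k *: (w^T *m w).
have HT : H^T = H.
  by rewrite /H linearB /= linearZ /= trmx_mul trmxK trmx1.
exists H; rewrite HT; split.
  pose q := (w *m w^T) 0 0; pose B := w^T *m w.
  have BB : B *m B = q *: B.
    by rewrite /B mulmxA -[w^T *m w *m w^T]mulmxA wwM mul_mx_scalar -scalemxAl.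
  rewrite /H -/B mulmxBl mul1mx mulmxBr mulmx1 -scalemxAl -scalemxAr BB.
  rewrite !scalerA opprB -[RHS]addr0 -addrA; congr (_ + _).
  rewrite -!scaleNr -!scalerDl.
  by rewrite [X in X *: _](_ : _ = 0) ?scale0r // /k -/q; field.
exists s; rewrite -/e /H mulmxBr mulmx1 -scalemxAr mulmxA.
have -> : e *m w^T = ((e *m w^T) 0 0)%:M by rewrite [LHS]mx11_scalar.
rewrite mul_scalar_mx scalerA.
(* Since [|u| = |e| = 1], [|w|^2 = 2 - 2 u_0 = - 2 (e w^T)], so [e H = e + w = u]. *)
have -> : k * (e *m w^T) 0 0 = -1.
  have ew : (e *m w^T) 0 0 = u 0 0 - 1.
    by rewrite /e -rowE !mxE !eqxx /= mulr1n.
  have weq : (w *m w^T) 0 0 = 2 - 2 * u 0 0.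
    rewrite {1}/w mulmxBl [LHS]mxE [(- _ : 'M_(_,_)) 0 0]mxE ew.
    rewrite /w linearB /= mulmxBr [(u *m u^T - _) 0 0]mxE uu.
    rewrite [(- _ : 'M_(_,_)) 0 0]mxE /e trmx_delta -colE [col _ _ 0 0]mxE; ring.
  rewrite /k ew weq; move: ww; rewrite weq => ww.
  by apply: (mulIf ww); rewrite mulrAC divfK //; ring.
by rewrite scaleN1r opprK /w addrC subrK.
Qed.

(** Deflation: after conjugation by a reflection sending the first basis row to an eigenvector
    direction, the first row and, by symmetry, the first column vanish off the diagonal. Induction
    applies to the remaining block. *)
Lemma symmetric_spectral (R : rcfType) n (A : 'M[R]_n) : A^T = A ->
  exists (V : 'M[R]_n) (d : 'rV[R]_n),
    [/\ V *m V^T = 1%:M, V^T *m V = 1%:M & V *m A *m V^T = diag_mx d].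
Proof.
move=> symA.
suff [V [d [VV VA]]] : exists (V : 'M[R]_n) (d : 'rV[R]_n),
    V *m V^T = 1%:M /\ V *m A *m V^T = diag_mx d.
  by exists V, d; split=> //; exact: mulmx1C.
move: symA.
elim: n A => [|n IHn]; last rewrite -[n.+1]/(1 + n)%N; move=> A symA.
  by exists 1%:M, 0; split; rewrite [LHS]flatmx0 [RHS]flatmx0.
have [a [v [v0 vA]]] := symmetric_eigenvector symA.
have [H [HH [c vH]]] := reflection_first_row v0.
have c0 : c != 0 by apply: contra_neq v0 => c0; rewrite vH c0 scale0r.
pose e : 'rV[R]_(1 + n) := delta_mx 0 0.
pose B : 'M[R]_(1 + n) := H *m A *m H^T.
have symB : B^T = B by rewrite /B !trmx_mul trmxK symA mulmxA.
have eB : e *m B = a *: e.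
  apply: (scalerI c0); rewrite /B !mulmxA -/e scalemxAl scalemxAl -vH.
  rewrite vA vH -/e -!scalemxAl -mulmxA HH mulmx1.
  by rewrite !scalerA mulrC.
pose A' : 'M[R]_n := drsubmx B.
have eB' : B = block_mx (a%:M : 'M_1) 0 0 A'.
  have row0 j : B 0 j = a *+ (j == 0).
    have /rowP/(_ j) := eB; rewrite /e -rowE !mxE eqxx /= => ->.
    by rewrite mulr_natr.
  have B0j j : B j 0 = a *+ (j == 0) by rewrite -symB mxE row0.
  rewrite /A'; clear symB eB; move: (B) row0 B0j => B2 row0 B0j.
  have l0 : lshift n (0 : 'I_1) = 0 by apply: val_inj.
  rewrite -[LHS]submxK; congr block_mx; apply/matrixP => i j; rewrite !ord1 !mxE.
  - by rewrite l0 row0 eqxx.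
  - by rewrite l0 row0.
  - by rewrite l0 B0j.
have symA' : A'^T = A'.
  by rewrite /A' trmx_drsub symB.
have [V' [d' [VV' VA']]] := IHn A' symA'.
pose W : 'M[R]_(1 + n) := block_mx 1%:M 0 0 V'.
have WT : W^T = block_mx 1%:M 0 0 V'^T by rewrite /W tr_block_mx !trmx0 trmx1.
exists (W *m H), (row_mx a%:M d'); split.
  rewrite trmx_mul mulmxA -[W *m H *m _]mulmxA HH mulmx1 WT /W.
  rewrite mulmx_block !mulmx0 !mul0mx !addr0 !mulmx1 add0r VV'.
  by rewrite -scalar_mx_block.
rewrite trmx_mul !mulmxA.
rewrite -[W *m H *m A]mulmxA -[W *m _ *m H^T]mulmxA -/B WT /W eB'.
rewrite !mulmx_block !mulmx0 !mul0mx !addr0 !add0r !mul0mx !mulmx1 !mul1mx VA'.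
rewrite diag_mx_row; congr block_mx.
by apply/matrixP => i j; rewrite !ord1 !mxE.
Qed.

Lemma row_quadE (R : comNzRingType) n (V A : 'M[R]_n) i :
  (row i V *m A *m (row i V)^T) 0 0 = (V *m A *m V^T) i i.
Proof. by rewrite -row_mul !mxE; apply: eq_bigr => j _; rewrite !mxE. Qed.

(** The eigenvalues of [X^T X] are squared norms [|v_k X^T|^2], so their square roots can be taken
    in the eigenbasis. This rules out the default value of [xget] in [nucnorm]. *)
Lemma gram_psd_root (R : realType) m n (X : 'M[R]_(m, n)) :
  exists P, psdmx P /\ P *m P = X^T *m X.
Proof.
have symG : (X^T *m X)^T = X^T *m X by rewrite trmx_mul trmxK.
have [V [d [VV V'V VG]]] := symmetric_spectral symG.
have d_ge0 k : 0 <= d 0 k.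
  have -> : d 0 k = (row k V *m X^T *m (row k V *m X^T)^T) 0 0.
    transitivity (diag_mx d k k); first by rewrite mxE eqxx mulr1n.
    by rewrite -VG -row_quadE trmx_mul trmxK !mulmxA.
  exact: sqnorm_ge0.
pose D : 'M[R]_n := diag_mx (\row_k Num.sqrt (d 0 k)).
have DD : D *m D = diag_mx d.
  rewrite /D mul_diag_mx; apply/matrixP => i j; rewrite !mxE.
  have [->|] := eqVneq i j; last by rewrite !mulr0n mulr0.
  by rewrite !mulr1n -expr2 sqr_sqrtr.
exists (V^T *m D *m V); split; last first.
  rewrite !mulmxA -[_ *m V *m V^T]mulmxA VV mulmx1 -[_ *m D *m D]mulmxA DD.
  by rewrite -VG !mulmxA V'V mul1mx -mulmxA V'V mulmx1.
split; first by rewrite !trmx_mul trmxK tr_diag_mx mulmxA.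
move=> v; have -> : v *m (V^T *m D *m V) *m v^T = v *m V^T *m D *m (v *m V^T)^T.
  by rewrite trmx_mul trmxK !mulmxA.
rewrite /D mul_mx_diag mxE sumr_ge0 // => k _; rewrite !mxE mulrAC.
by rewrite mulr_ge0 ?sqrtr_ge0 // -expr2 sqr_ge0.
Qed.

Lemma nucnormP (R : realType) m n (X : 'M[R]_(m, n)) :
  exists P, [/\ psdmx P, P *m P = X^T *m X & nucnorm X = \tr P].
Proof.
have [P HP] := gram_psd_root X.
rewrite /nucnorm; set S := (X in xget _ X).
by have [psdQ QQ] : S (xget 0 S) := xgetI 0 HP; exists (xget 0 S).
Qed.

Section TraceDuality.
Variables (R : realType) (m n : nat) (N : 'M[R]_(m, n)) (k : R).
Hypothesis normN : forall (u : 'rV[R]_m) (v : 'rV[R]_n),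
  (u *m u^T) 0 0 <= 1 -> (v *m v^T) 0 0 <= 1 -> (u *m N *m v^T) 0 0 <= k.

Lemma bilinear_le_scaled (p : R) (u : 'rV[R]_m) (v : 'rV[R]_n) : 0 <= p ->
  (u *m u^T) 0 0 = p ^+ 2 -> (v *m v^T) 0 0 = 1 ->
  (u *m N *m v^T) 0 0 <= k * p.
Proof.
rewrite le_eqVlt => /orP[/eqP<-|p_gt0] uu vv.
  rewrite expr0n /= in uu.
  by rewrite (sqnorm_eq0 uu) !mul0mx mxE mulr0.
rewrite -ler_pdivrMr // mulrC.
have -> : p^-1 * (u *m N *m v^T) 0 0 = (p^-1 *: u *m N *m v^T) 0 0.
  by rewrite -!scalemxAl [RHS]mxE.
apply: normN; last by rewrite vv.
rewrite linearZ /= -scalemxAl -scalemxAr scalerA mxE uu.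
by rewrite expr2 mulrA mulfVK ?mulVf ?gt_eqF.
Qed.

(** Take the trace in an orthonormal eigenbasis [v_i] of the root [P]. Then
    [|v_i X^T|^2 = v_i P^2 v_i^T = p_i^2], so the [i]-th term is at most [k p_i], and the [p_i] sum
    to the trace of [P]. *)
Lemma trace_duality (X : 'M[R]_(m, n)) : \tr (X^T *m N) <= k * nucnorm X.
Proof.
have [P [[symP psdP] PP ->]] := nucnormP X.
have [V [p [VV V'V VP]]] := symmetric_spectral symP.
have trV (Z : 'M[R]_n) :
    \tr Z = \sum_i (row i V *m Z *m (row i V)^T) 0 0.
  transitivity (\tr (V *m Z *m V^T)).
    by rewrite mxtrace_mulC mulmxA V'V mul1mx.
  by apply: eq_bigr => i _; rewrite row_quadE.
rewrite [X in X <= _]trV [X in _ * X]trV mulr_sumr; apply: ler_sum => i _.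
have Pi : (row i V *m P *m (row i V)^T) 0 0 = p 0 i.
  by rewrite row_quadE VP mxE eqxx mulr1n.
rewrite Pi mulmxA; apply: bilinear_le_scaled; first by rewrite -Pi.
  rewrite trmx_mul trmxK mulmxA -[_ *m X^T *m X]mulmxA -PP row_quadE.
  have -> : V *m (P *m P) *m V^T = (V *m P *m V^T) *m (V *m P *m V^T).
    by rewrite !mulmxA -[_ *m V^T *m V]mulmxA V'V mulmx1.
  by rewrite VP mul_diag_mx !mxE eqxx mulr1n expr2.
by have := row_quadE V 1%:M i; rewrite !mulmx1 VV [1%:M _ _]mxE eqxx.
Qed.
End TraceDuality.

Lemma nucnorm_ge0 (R : realType) m n (X : 'M[R]_(m, n)) : 0 <= nucnorm X.
Proof.
have [P [[_ psdP] _ ->]] := nucnormP X.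
apply: sumr_ge0 => i _; have := psdP (row i 1%:M).
by rewrite row_quadE trmx1 mulmx1 mul1mx.
Qed.

(** * Concentration for independent Boolean variables *)

(** The linear term averages out for a centred variable. For [x >= 1/2], [x <= 2 x^2]; below that,
    [expR x <= 1 / (1 - x) <= 1 + x + 2 x^2], the last step because [x^2 (1 - 2 x) >= 0]. *)
Lemma expR_le_add_expR_sqr (R : realType) (x : R) : expR x <= x + expR (2 * x ^+ 2).
Proof.
have inv_bound (y : R) : y < 1 -> expR y <= (1 - y)^-1.
  move=> y1; rewrite -[y in expR y]opprK expRN lef_pV2 ?posrE ?expR_gt0 ?subr_gt0 //.
  by have := expR_ge1Dx (- y); lra.
have sqr_bound := expR_ge1Dx (2 * x ^+ 2).
have [x_big|x_small] := leP (1 / 2) x.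
  have : expR x <= expR (2 * x ^+ 2) by rewrite ler_expR expr2; nra.
  by move: x_big; lra.
apply: le_trans (_ : (1 - x)^-1 <= _); first by apply: inv_bound; lra.
rewrite -div1r ler_pdivrMr; last by lra.
apply: le_trans (_ : (1 + x + 2 * x ^+ 2) * (1 - x) <= _).
  by have := sqr_ge0 x; rewrite expr2; nra.
by rewrite ler_pM2r; lra.
Qed.

(** Hoeffding's lemma for two points: the deviations from the mean are [q (a - b)] and [p (b - a)],
    of size at most [d], and their weighted sum is zero. *)
Lemma two_point_mgf (R : realType) (p q a b d : R) :
  0 <= p -> 0 <= q -> p + q = 1 -> `|a - b| <= d ->
  p * expR a + q * expR b <= expR (p * a + q * b + 2 * d ^+ 2).
Proof.
move=> p0 q0 pq1 abd; set mu := p * a + q * b.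
have dev (c r : R) : 0 <= r <= 1 -> `|c| <= d -> expR (r * c) <= r * c + expR (2 * d ^+ 2).
  move=> /andP[r0 r1] cd; apply: le_trans (expR_le_add_expR_sqr _) _.
  rewrite lerD2l ler_expR ler_pM2l // exprMn -[c ^+ 2]real_normK ?num_real //.
  have h1 : r ^+ 2 <= 1 by rewrite expr_le1.
  have h2 : `|c| ^+ 2 <= d ^+ 2 by rewrite lerXn2r ?nnegrE // (le_trans _ cd).
  by apply: le_trans h2; rewrite ler_piMl ?exprn_ge0.
have da : expR (a - mu) <= (a - mu) + expR (2 * d ^+ 2).
  have -> : a - mu = q * (a - b) by rewrite /mu (_ : q = 1 - p); [ring | lra].
  by apply: dev => //; lra.
have db : expR (b - mu) <= (b - mu) + expR (2 * d ^+ 2).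
  have -> : b - mu = p * (b - a) by rewrite /mu (_ : q = 1 - p); [ring | lra].
  by apply: dev; [lra | rewrite distrC].
have -> : p * expR a + q * expR b = expR mu * (p * expR (a - mu) + q * expR (b - mu)).
  by rewrite mulrDr !(mulrCA (expR mu)) -!expRD !subrKC.
rewrite [X in _ <= X]expRD ler_pM2l ?expR_gt0 //.
apply: le_trans (lerD (ler_wpM2l p0 da) (ler_wpM2l q0 db)) _.
have e : p * (a - mu) + q * (b - mu) = 0.
  by rewrite /mu (_ : q = 1 - p); [ring | lra].
by rewrite mulrDr [q * (_ + expR _)]mulrDr addrACA e add0r -mulrDl pq1 mul1r.
Qed.

(** * Product measures on the Boolean cube, McDiarmid's inequality and Jensen's inequality *)

Section ProductMeasure.
Variables (R : realType) (I : finType) (q : I -> bool -> R).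
Hypothesis q_ge0 : forall i b, 0 <= q i b.
Hypothesis q_sum1 : forall i, q i true + q i false = 1.

Implicit Types (x y : {ffun I -> bool}) (f g : {ffun I -> bool} -> R).

Definition weight x : R := \prod_i q i (x i).
Definition expect f : R := \sum_x weight x * f x.
Definition flip (i : I) x : {ffun I -> bool} := [ffun j => x j (+) (j == i)].
(** The conditional expectation of [f] given all coordinates other than [i]. *)
Definition average i f x : R :=
  q i (x i) * f x + q i (~~ x i) * f (flip i x).
Definition bounded_differences (d : I -> R) f : Prop :=
  forall i x, `|f x - f (flip i x)| <= d i.

Lemma weight_ge0 x : 0 <= weight x.
Proof. by apply: prodr_ge0. Qed.

Lemma q_sum i b : q i b + q i (~~ b) = 1.
Proof. by case: b; rewrite //= addrC q_sum1. Qed.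

Lemma flipK i : involutive (flip i).
Proof. by move=> x; apply/ffunP => j; rewrite !ffunE addbK. Qed.

Lemma flipC i j x : flip i (flip j x) = flip j (flip i x).
Proof. by apply/ffunP => k; rewrite !ffunE addbAC. Qed.

Lemma flipE i x : flip i x i = ~~ x i.
Proof. by rewrite ffunE eqxx addbT. Qed.

Lemma flip_neq i j x : j != i -> flip i x j = x j.
Proof. by move=> /negbTE ji; rewrite ffunE ji addbF. Qed.

(** Detailed balance for resampling coordinate [i]; it is what makes [average] preserve
    expectations. *)
Lemma weight_flip i x : q i (~~ x i) * weight x = q i (x i) * weight (flip i x).
Proof.
rewrite /weight (bigD1 i) //= [in RHS](bigD1 i) //= flipE mulrCA; congr (_ * (_ * _)).
by apply: eq_bigr => j ji; rewrite flip_neq.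
Qed.

Lemma expect_average i f : expect (average i f) = expect f.
Proof.
rewrite /expect /average.
under eq_bigr do rewrite mulrDr.
rewrite big_split /=.
have -> : \sum_x weight x * (q i (~~ x i) * f (flip i x)) =
          \sum_x weight x * (q i (~~ x i) * f x).
  rewrite (reindex_inj (inv_inj (flipK i))) /=; apply: eq_bigr => x _.
  by rewrite flipK flipE negbK !mulrA ![weight _ * _]mulrC weight_flip.
rewrite -big_split /=; apply: eq_bigr => x _.
by rewrite -mulrDr -mulrDl q_sum mul1r.
Qed.

Lemma weight_sum1 : \sum_x weight x = 1.
Proof.
rewrite /weight -(bigA_distr_bigA (fun i b => q i b)) /=.
by apply: big1 => i _; rewrite big_bool /= q_sum1.
Qed.

Lemma le_expect f g : (forall x, f x <= g x) -> expect f <= expect g.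
Proof. by move=> fg; apply: ler_sum => x _; rewrite ler_wpM2l ?weight_ge0. Qed.

Lemma expect_cst c : expect (fun=> c) = c.
Proof. by rewrite /expect -mulr_suml weight_sum1 mul1r. Qed.

Lemma expectZ c f : expect (fun x => c * f x) = c * expect f.
Proof. by rewrite /expect mulr_sumr; apply: eq_bigr => x _; rewrite mulrCA. Qed.

Lemma expectD f g : expect (fun x => f x + g x) = expect f + expect g.
Proof. by rewrite /expect -big_split; apply: eq_bigr => x _; rewrite mulrDr. Qed.

Lemma expect_sum (J : finType) (P : pred J) (F : J -> {ffun I -> bool} -> R) :
  expect (fun x => \sum_(j | P j) F j x) = \sum_(j | P j) expect (F j).
Proof.
rewrite /expect exchange_big; apply: eq_bigr => x _; exact: mulr_sumr.
Qed.

(** Flips at different coordinates commute, so the difference of averages is a convex combination of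
    differences of [f]; flipping [i] itself changes nothing. *)
Lemma bounded_differences_average d f i :
  bounded_differences d f -> bounded_differences d (average i f).
Proof.
move=> bd j x; rewrite /average.
have [->|ij] := eqVneq i j.
  rewrite flipK flipE negbK [X in _ - X]addrC subrr normr0.
  exact: le_trans (normr_ge0 _) (bd j x).
rewrite flip_neq // -[flip i (flip j x)]flipC opprD addrACA -!mulrBr.
apply: le_trans (ler_normD _ _) _; rewrite !normrM !(ger0_norm (q_ge0 _ _)).
rewrite -[d j]mul1r -(q_sum i (x i)) mulrDl.
by apply: lerD; rewrite ler_wpM2l.
Qed.

Lemma average_expR d f i x : bounded_differences d f ->
  average i (fun y => expR (f y)) x <= expR (average i f x + 2 * d i ^+ 2).
Proof. by move=> bd; apply: two_point_mgf; rewrite ?q_sum. Qed.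

Definition averages s f := foldr average f s.

Lemma bounded_differences_averages d f s :
  bounded_differences d f -> bounded_differences d (averages s f).
Proof. by move=> bd; elim: s => //= i s; apply: bounded_differences_average. Qed.

Lemma expect_averages s f : expect (averages s f) = expect f.
Proof. by elim: s => //= i s <-; apply: expect_average. Qed.

Lemma average_flip i f x : average i f (flip i x) = average i f x.
Proof. by rewrite /average flipK flipE negbK addrC. Qed.

Lemma averages_flip s f i x : i \in s -> averages s f (flip i x) = averages s f x.
Proof.
elim: s x => //= j s IHs x; have [->|ij] := eqVneq i j; first by rewrite average_flip.
rewrite inE (negbTE ij) /= => /IHs {}IHs.
by rewrite /average flip_neq 1?eq_sym // flipC !IHs.
Qed.

(** Move from [x] to [y] through hybrids that agree with [y] on the coordinates in [s] and with [x]
    elsewhere. *)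
Lemma flip_invariant_cst f x y : (forall i z, f (flip i z) = f z) -> f x = f y.
Proof.
move=> inv.
suff H (s : seq I) : f x = f [ffun i => if i \in s then y i else x i].
  by rewrite (H (enum I)); congr f; apply/ffunP => i; rewrite ffunE mem_enum.
elim: s => [|i s ->]; first by congr f; apply/ffunP => i; rewrite ffunE.
set z := (X in f X = _).
have [yz|yz] := eqVneq (y i) (z i).
  congr f; apply/ffunP => j; rewrite [RHS]ffunE inE.
  by have [->|_] := eqVneq j i; rewrite //= /z ffunE.
rewrite -(inv i z); congr f; apply/ffunP => j; rewrite [LHS]ffunE [RHS]ffunE inE.
have [->|ji] := eqVneq j i; last by rewrite addbF /z ffunE.
by move: yz; case: (y i); case: (z i).
Qed.

(** Plays the part of the martingale argument: integrating out one more coordinate inside the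
    exponential costs the factor [expR (2 d_i^2)]. *)
Lemma mgf_averages d f s : bounded_differences d f ->
  expect (fun x => expR (f x)) <=
  expR (\sum_(i <- s) 2 * d i ^+ 2) * expect (fun x => expR (averages s f x)).
Proof.
move=> bd; elim: s => [|i s IHs] /=; first by rewrite big_nil expR0 mul1r.
apply: le_trans IHs _; rewrite big_cons addrC expRD -mulrA.
rewrite ler_pM2l ?expR_gt0 // -expectZ -(expect_average i).
apply: le_expect => x; rewrite mulrC -expRD.
exact/average_expR/bounded_differences_averages.
Qed.

(* McDiarmid's inequality in exponential form, with 2 in place of the optimal
   constant 1/8. *)
Lemma mcdiarmid_mgf d f : bounded_differences d f ->
  expect (fun x => expR (f x)) <= expR (expect f + \sum_i 2 * d i ^+ 2).
Proof.
move=> bd; apply: le_trans (mgf_averages (index_enum I) bd) _.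
(* Averaging over every coordinate leaves a constant, equal to [expect f]; the evaluation point is
   arbitrary. *)
pose c := averages (index_enum I) f [ffun=> true].
have cE x : averages (index_enum I) f x = c.
  by apply: flip_invariant_cst => i z; rewrite averages_flip ?mem_index_enum.
rewrite -(expect_averages (index_enum I) f) addrC expRD ler_pM2l ?expR_gt0 //.
rewrite /expect (eq_bigr (fun x => weight x * expR c)) => [|x _]; last by rewrite cE.
rewrite [X in _ <= expR X](eq_bigr (fun x => weight x * c)) => [|x _]; last by rewrite cE.
by rewrite -!mulr_suml weight_sum1 !mul1r.
Qed.

Lemma mcdiarmid_tail (D s : R) f : 0 < D -> 0 <= s ->
  (exists2 d, bounded_differences d f & \sum_i d i ^+ 2 <= D) ->
  \sum_(x | expect f + s <= f x) weight x <= expR (- (s ^+ 2 / (8 * D))).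
Proof.
(* Chernoff's method; this [l] minimises [- l s + 2 l^2 D], with value [- s^2 / (8 D)]. *)
move=> D0 s0 [d bd dD]; pose l := s / (4 * D).
have l0 : 0 <= l by rewrite divr_ge0 // mulr_ge0 // ltW.
have bdl : bounded_differences (fun i => l * d i) (fun x => l * f x).
  by move=> i x; rewrite -mulrBr normrM ger0_norm // ler_wpM2l.
have := mcdiarmid_mgf bdl; rewrite expectZ => mgf.
have chernoff : \sum_(x | expect f + s <= f x) weight x <=
    expR (- (l * (expect f + s))) * expect (fun x => expR (l * f x)).
  rewrite -expectZ /expect [X in _ <= X](bigID (fun x => expect f + s <= f x)) /=.
  apply: ler_wpDr.
    by apply: sumr_ge0 => x _; rewrite !mulr_ge0 ?weight_ge0 ?expR_ge0.
  apply: ler_sum => x fx; rewrite ler_peMr ?weight_ge0 // -expRD.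
  rewrite -[X in X <= _]expR0 ler_expR addrC subr_ge0 ler_wpM2l //.
apply: le_trans chernoff _.
apply: le_trans (ler_wpM2l (expR_ge0 _) mgf) _.
rewrite -expRD ler_expR.
have -> : \sum_i 2 * (l * d i) ^+ 2 = 2 * l ^+ 2 * \sum_i d i ^+ 2.
  by rewrite mulr_sumr; apply: eq_bigr => i _; rewrite exprMn mulrA.
have h : 2 * l ^+ 2 * (\sum_i d i ^+ 2) <= 2 * l ^+ 2 * D.
  by rewrite ler_wpM2l // mulr_ge0 ?sqr_ge0.
apply: le_trans (_ : - (l * s) + 2 * l ^+ 2 * D <= _); first lra.
by rewrite /l le_eqVlt; apply/orP; left; apply/eqP; field; rewrite gt_eqF.
Qed.

Lemma expect_gt0 f : (forall x, 0 < f x) -> 0 < expect f.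
Proof.
move=> f0; have f_ge0 x : 0 <= weight x * f x by rewrite mulr_ge0 ?weight_ge0 // ltW.
rewrite lt_def sumr_ge0 // andbT; apply/eqP => /eqP.
rewrite psumr_eq0 // => /allP H; have /eqP := weight_sum1.
rewrite big1 ?(eq_sym 0) ?oner_eq0 // => x _.
by have := H x (mem_index_enum x); rewrite /= mulf_eq0 (gt_eqF (f0 x)) orbF => /eqP.
Qed.

(** Integrate the tangent line bound [ln y <= ln a + y / a - 1] at [a = expect f]. *)
Lemma jensen_ln f : (forall x, 0 < f x) -> expect (fun x => ln (f x)) <= ln (expect f).
Proof.
move=> f0; have a0 := expect_gt0 f0; set a := expect f in a0 *.
apply: le_trans (_ : expect (fun x => (ln a - 1) + a^-1 * f x) <= _).
  apply: le_expect => x.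
  have fa : 0 < f x / a by rewrite divr_gt0.
  have -> : ln (f x) = ln a + ln (f x / a).
    by rewrite -lnM ?posrE // mulrC divfK // gt_eqF.
  have := @le_ln1Dx R (f x / a - 1); rewrite subrKC => h.
  have := h _; rewrite ltrBrDl subrr => /(_ fa) {}h.
  by rewrite -addrA lerD2l [-1 + _]addrC [a^-1 * _]mulrC.
rewrite expectD expectZ expect_cst -/a mulVf ?gt_eqF //; lra.
Qed.

End ProductMeasure.

(** * Spectral norm of the noise *)

(* Integer vectors with entries of size at most [m + 1], each entry being given
   by a sign and an absolute value; zero is counted twice. *)
Definition lattice m := {ffun 'I_m -> bool * 'I_m.+2}.

Definition coordinate (R : realType) m (z : lattice m) (i : 'I_m) : R :=
  (-1) ^+ (z i).1 * (z i).2%:R.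

Definition in_ball (R : realType) m (z : lattice m) : bool :=
  \sum_i coordinate R z i ^+ 2 <= 4 * m%:R.

(** Round [x] to zero when [c x <= 0], and away from zero otherwise; neither decreases the product
    with [c]. *)
Lemma round_coordinate (R : realType) k (x c : R) : `|x| <= k%:R ->
  exists z : bool * 'I_k.+2, let r := (-1) ^+ z.1 * z.2%:R in
    c * x <= c * r /\ `|r| <= `|x| + 1.
Proof.
move=> xk; have [cx|cx] := leP (c * x) 0.
  by exists (false, ord0); rewrite /= mulr0 mulr0 normr0 addr_ge0.
have lt_trunc : ((Num.truncn `|x|).+1 < k.+2)%N.
  rewrite !ltnS -(ler_nat R); apply: le_trans xk.
  by have /andP[] := truncn_itv (normr_ge0 x).
have /andP[tl tu] := truncn_itv (normr_ge0 x).
exists (x < 0, Ordinal lt_trunc); rewrite /= normrM normrX normrN1 expr1n mul1r.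
split; last by rewrite ger0_norm // -natr1 lerD2r.
(* As [c x > 0], [c] times the sign of [x] is positive, and only the absolute values remain to be
   compared. *)
rewrite {1}[x]numEsign mulrA [in leRHS]mulrA ler_pM2l ?ltW //.
by rewrite -(pmulr_lgt0 _ (_ : 0 < `|x|)) -?mulrA -?numEsign // normr_gt0;
  apply: contraTneq cx => ->; rewrite mulr0 ltxx.
Qed.

(** Rounding gives [r^2 <= (|x_i| + 1)^2 <= 2 x_i^2 + 2] in each coordinate, which sums to at most
    [4 m], the bound in [in_ball]. *)
Lemma round_vector (R : realType) m (x c : 'I_m -> R) :
  \sum_i x i ^+ 2 <= m%:R ->
  exists2 z : lattice m, in_ball R z &
    \sum_i c i * x i <= \sum_i c i * coordinate R z i.
Proof.
move=> xm.
have xi i : `|x i| <= m%:R.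
  have m_gt0 : (0 < m)%N by apply: leq_trans (ltn_ord i).
  rewrite -(@ler_pXn2r _ 2) ?nnegrE // real_normK ?num_real //.
  apply: le_trans (_ : m%:R <= _); last by rewrite -natrX ler_nat expnS expn1 leq_pmulr.
  apply: le_trans xm; rewrite (bigD1 i) //= lerDl.
  by apply: sumr_ge0 => j _; apply: sqr_ge0.
have [z zP] := fin_all_exists (fun i => round_coordinate (c i) (xi i)).
exists (finfun z); last first.
  by apply: ler_sum => i _; rewrite /coordinate ffunE; case: (zP i).
rewrite /in_ball; apply: le_trans (_ : \sum_i (2 * x i ^+ 2 + 2) <= _).
  apply: ler_sum => i _; rewrite /coordinate ffunE; have [_ zi] := zP i.
  set r := (X in `|X| <= _) in zi; rewrite -/r -[r ^+ 2]real_normK ?num_real //.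
  rewrite -[x i ^+ 2]real_normK ?num_real //.
  have := normr_ge0 r; have := normr_ge0 (x i).
  move: (`|r|) (`|x i|) zi => a b ab b0 a0.
  have h : a ^+ 2 <= (b + 1) ^+ 2 by rewrite lerXn2r ?nnegrE // addr_ge0.
  have := sqr_ge0 (b - 1); rewrite !expr2 in h *; nra.
rewrite big_split /= -mulr_sumr sumr_const card_ord -mulr_natr; lra.
Qed.

Lemma expR1_ge2 (R : realType) : 2 <= expR 1 :> R.
Proof. by have := expR_ge1Dx (1 : R). Qed.

(** Since [a^2 >= a] and [expR 1 >= 2], a geometric series of ratio [1/2] dominates. *)
Lemma sum_expR_sqr (R : realType) k : \sum_(a < k) expR (- (a%:R ^+ 2)) <= 2 :> R.
Proof.
have half : forall a : nat, expR (- (a%:R ^+ 2)) <= 2^-1 ^+ a :> R.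
  move=> a; apply: le_trans (_ : expR (- a%:R) <= _).
    rewrite ler_expR lerN2 -natrX ler_nat; case: a => // a.
    by rewrite expnS leq_pmulr.
  rewrite -[a%:R]mulr1 -mulrN expRM_natl lerXn2r ?nnegrE ?expR_ge0 ?invr_ge0 //.
  by rewrite expRN lef_pV2 ?posrE ?expR_gt0 ?expR1_ge2.
apply: le_trans (_ : \sum_(i < k) 2^-1 ^+ i <= _).
  by apply: ler_sum => i _; exact: half.
suff -> : \sum_(i < k) 2^-1 ^+ i = 2 - 2 * 2^-1 ^+ k :> R.
  by rewrite gerBl mulr_ge0 ?exprn_ge0 ?invr_ge0.
elim: k => [|k IHk]; first by rewrite big_ord0 expr0; ring.
by rewrite big_ord_recr /= IHk exprS; field.
Qed.

(* Each [z] in the ball contributes at least 1 to the sum over the whole box of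
   [expR (4 m - |z|^2)], which factors over the coordinates. *)
Lemma card_ball (R : realType) m :
  \sum_(z : lattice m | in_ball R z) 1 <= expR (6 * m%:R) :> R.
Proof.
apply: le_trans (_ : \sum_(z : lattice m)
    expR (4 * m%:R) * \prod_i expR (- coordinate R z i ^+ 2) <= _).
  rewrite [X in _ <= X](bigID (@in_ball R m)) /= ler_wpDr //.
    by apply: sumr_ge0 => z _; rewrite mulr_ge0 ?expR_ge0 ?prodr_ge0 // => i _; rewrite expR_ge0.
  apply: ler_sum => z zb; rewrite -expR_sum -expRD -[X in X <= _]expR0 ler_expR.
  by rewrite sumrN subr_ge0.
rewrite -mulr_sumr.
have -> : \sum_(z : lattice m) \prod_i expR (- coordinate R z i ^+ 2) =
   \prod_(i < m) \sum_(s : bool * 'I_m.+2) expR (- ((-1) ^+ s.1 * s.2%:R) ^+ 2) :> R.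
  by rewrite bigA_distr_bigA.
(* Each sign contributes at most 2, and [4 <= expR 2]; over [m] coordinates this adds [2 m] to the
   exponent [4 m]. *)
have le4 : \sum_(s : bool * 'I_m.+2) expR (- ((-1) ^+ s.1 * s.2%:R) ^+ 2) <= expR 2 :> R.
  rewrite -(pair_bigA _ (fun (b : bool) (a : 'I_m.+2) => expR (- ((-1) ^+ b * a%:R) ^+ 2))) /=.
  rewrite big_bool /=.
  under eq_bigr do rewrite exprMn sqrr_sign mul1r.
  under [X in _ + X]eq_bigr do rewrite exprMn sqrr_sign mul1r.
  apply: le_trans (lerD (sum_expR_sqr R _) (sum_expR_sqr R _)) _.
  have -> : expR 2 = expR 1 ^+ 2 :> R by rewrite -expRM_natl mulr1.
  have := expR1_ge2 R; rewrite expr2; nra.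
rewrite prodr_const card_ord (_ : 6 * m%:R = 4 * m%:R + m%:R * 2); last by ring.
rewrite expRD ler_pM2l ?expR_gt0 // expRM_natl lerXn2r ?nnegrE ?expR_ge0 //.
by apply: sumr_ge0 => s _; rewrite expR_ge0.
Qed.

Definition lattice_form (R : realType) m n (N : 'M[R]_(m, n)) (z : lattice m) (w : lattice n) : R :=
  \sum_i \sum_j N i j * (coordinate R z i * coordinate R w j).

(** Its logarithm divided by [l > 0] is a smooth upper bound for the maximum of the form over the
    net. *)
Definition exp_sum (R : realType) m n (l : R) (N : 'M[R]_(m, n)) : R :=
  \sum_(z : lattice m | in_ball R z) \sum_(w : lattice n | in_ball R w)
    expR (l * lattice_form N z w).

Lemma expR_form_le_exp_sum (R : realType) m n (l : R) (N : 'M[R]_(m, n)) z w :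
  in_ball R z -> in_ball R w -> expR (l * lattice_form N z w) <= exp_sum l N.
Proof.
move=> zb wb; rewrite /exp_sum (bigD1 z) //= (bigD1 w) //= -addrA lerDl addr_ge0 //.
  by apply: sumr_ge0 => ? _; rewrite expR_ge0.
by apply: sumr_ge0 => ? _; apply: sumr_ge0 => ? _; rewrite expR_ge0.
Qed.

Lemma exp_sum_gt0 (R : realType) m n (l : R) (N : 'M[R]_(m, n)) : 0 < exp_sum l N.
Proof.
have zero_in_ball k : in_ball R ([ffun=> (false, ord0)] : lattice k).
  rewrite /in_ball big1 ?mulr_ge0 // => i _.
  by rewrite /coordinate ffunE /= mulr0 expr0n.
exact: lt_le_trans (expR_gt0 _)
  (expR_form_le_exp_sum l N (zero_in_ball m) (zero_in_ball n)).
Qed.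

(* Scaled by [sqrt m] and [sqrt n], unit vectors can be rounded to integer vectors
   of squared norm at most [4 m] and [4 n] one after the other without decreasing
   the bilinear form, because it is linear in each coordinate. *)
Lemma bilinear_le_exp_sum (R : realType) m n (l : R) (N : 'M[R]_(m, n))
    (u : 'rV[R]_m) (v : 'rV[R]_n) :
  (0 < m)%N -> (0 < n)%N -> 0 < l ->
  (u *m u^T) 0 0 <= 1 -> (v *m v^T) 0 0 <= 1 ->
  (u *m N *m v^T) 0 0 <= ln (exp_sum l N) / (l * Num.sqrt (m * n)%:R).
Proof.
move=> m_gt0 n_gt0 l0 uu vv.
have scaled k (r : 'rV[R]_k) : (r *m r^T) 0 0 <= 1 ->
    \sum_i (Num.sqrt k%:R * r 0 i) ^+ 2 <= k%:R.
  move=> rr; under eq_bigr do rewrite exprMn sqr_sqrtr //.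
  rewrite -mulr_sumr ler_piMr //; apply: le_trans rr.
  by rewrite mxE le_eqVlt; apply/orP; left; apply/eqP/eq_bigr => i _; rewrite mxE.
pose x i := Num.sqrt m%:R * u 0 i; pose y j := Num.sqrt n%:R * v 0 j.
have [z zb zP] := round_vector (fun i => \sum_j N i j * y j) (scaled _ _ uu).
have [w wb wP] := round_vector (fun j => \sum_i N i j * coordinate R z i) (scaled _ _ vv).
have le_form : Num.sqrt (m * n)%:R * (u *m N *m v^T) 0 0 <= lattice_form N z w.
  apply: le_trans (_ : \sum_j (\sum_i N i j * coordinate R z i) * coordinate R w j <= _); last first.
    rewrite /lattice_form exchange_big /= le_eqVlt; apply/orP; left; apply/eqP.
    by apply: eq_bigr => j _; rewrite mulr_suml; apply: eq_bigr => i _; rewrite mulrA.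
  apply: le_trans wP.
  apply: le_trans (_ : \sum_i (\sum_j N i j * y j) * coordinate R z i <= _); last first.
    rewrite le_eqVlt; apply/orP; left; apply/eqP.
    under eq_bigr do rewrite mulr_suml.
    rewrite exchange_big /=; apply: eq_bigr => j _; rewrite mulr_suml.
    by apply: eq_bigr => i _; rewrite mulrAC.
  apply: le_trans zP.
  rewrite le_eqVlt; apply/orP; left; apply/eqP.
  rewrite natrM sqrtrM // mxE mulr_sumr.
  under eq_bigr do rewrite mxE mulr_suml mulr_sumr.
  rewrite exchange_big /=; apply: eq_bigr => i _; rewrite mulr_suml.
  by apply: eq_bigr => j _; rewrite /y mxE; ring.
have sq0 : 0 < Num.sqrt (m * n)%:R :> R by rewrite sqrtr_gt0 ltr0n muln_gt0 m_gt0.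
rewrite ler_pdivlMr ?mulr_gt0 // mulrCA [_ * Num.sqrt _]mulrC.
apply: le_trans (_ : l * lattice_form N z w <= _); first by rewrite ler_pM2l.
rewrite -[X in X <= _]expRK ler_ln ?posrE ?expR_gt0 ?exp_sum_gt0 //.
exact: expR_form_le_exp_sum.
Qed.

(** * Exponential moments of the noise *)

Section NoiseMatrix.
Variables (R : realType) (m n : nat) (q : 'I_m * 'I_n -> bool -> R) (b : R).
Hypothesis q_ge0 : forall i a, 0 <= q i a.
Hypothesis q_sum1 : forall i, q i true + q i false = 1.
Hypothesis b_gt0 : 0 < b.

Implicit Type x : {ffun 'I_m * 'I_n -> bool}.

Definition noise x : 'M[R]_(m, n) :=
  \matrix_(i, j) (b * ((x (i, j))%:R - q (i, j) true)).

Lemma expect_noise i j : expect q (fun x => noise x i j) = 0.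
Proof.
rewrite -(expect_average q_sum1 (i, j)) -[RHS](expect_cst q_sum1 0).
apply: eq_bigr => x _; congr (_ * _); rewrite /average !mxE flipE.
have := q_sum1 (i, j); case: (x (i, j)) => /= h; nra.
Qed.

Lemma noise_flip p x i j :
  noise x i j - noise (flip p x) i j =
  (if (i, j) == p then b * (-1) ^+ (~~ x p) else 0).
Proof.
rewrite !mxE; have [<-|ijp] := eqVneq; last by rewrite flip_neq // subrr.
by rewrite flipE; case: (x _); rewrite /= ?expr0 ?expr1; ring.
Qed.

Lemma noise_linear_flip (c : 'I_m -> 'I_n -> R) p x :
  \sum_i \sum_j noise x i j * c i j - \sum_i \sum_j noise (flip p x) i j * c i j =
  b * (-1) ^+ (~~ x p) * c p.1 p.2.
Proof.
rewrite !pair_bigA /= -sumrB (bigD1 p) //= big1 => [|k kp].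
  by rewrite -mulrBl noise_flip -surjective_pairing eqxx addr0.
by rewrite -mulrBl noise_flip -surjective_pairing (negbTE kp) mul0r.
Qed.

(** The form is centred, and flipping entry [(i, j)] moves it by [|l b z_i w_j|]. McDiarmid's
    exponent is thus [2 (l b)^2 |z|^2 |w|^2], and [32 = 2 * 4 * 4]. *)
Lemma expect_exp_form l (z : lattice m) (w : lattice n) :
  in_ball R z -> in_ball R w ->
  expect q (fun x => expR (l * lattice_form (noise x) z w)) <=
  expR (32 * (l * b) ^+ 2 * (m * n)%:R).
Proof.
move=> zb wb.
pose d (p : 'I_m * 'I_n) := `|l * b * (coordinate R z p.1 * coordinate R w p.2)|.
have bd : bounded_differences d (fun x => l * lattice_form (noise x) z w).
  move=> p x; rewrite -mulrBr /lattice_form noise_linear_flip /d !normrM normrX normrN1 expr1n.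
  by rewrite mulr1 !mulrA.
apply: le_trans (mcdiarmid_mgf q_ge0 q_sum1 bd) _; rewrite ler_expR.
rewrite (@expectZ _ _ q) (_ : expect q _ = 0) ?mulr0 ?add0r; last first.
  rewrite /lattice_form expect_sum big1 // => i _; rewrite expect_sum big1 // => j _.
  rewrite [LHS](_ : _ = (coordinate R z i * coordinate R w j) * expect q (fun x => noise x i j)).
    by rewrite expect_noise mulr0.
  by rewrite -expectZ; apply: eq_bigr => x _; congr (_ * _); rewrite mulrC.
have -> : \sum_p 2 * d p ^+ 2 = 2 * (l * b) ^+ 2 *
    ((\sum_i coordinate R z i ^+ 2) * (\sum_j coordinate R w j ^+ 2)).
  rewrite big_distrlr /= pair_bigA /= mulr_sumr; apply: eq_bigr => p _.
  by rewrite /d real_normK ?num_real // !exprMn; ring.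
rewrite natrM (_ : 32 * _ * _ = 2 * (l * b) ^+ 2 * ((4 * m%:R) * (4 * n%:R))); last by ring.
apply: ler_wpM2l; first by rewrite mulr_ge0 ?sqr_ge0.
by apply: ler_pM => //; apply: sumr_ge0 => i _; exact: sqr_ge0.
Qed.

(** Jensen moves the expectation inside the logarithm. The choice of [l] makes
    [(l b)^2 m n = m + n], so each exponential moment gives [32 (m + n)] and the two nets add
    [6 m + 6 n]. *)
Lemma expect_ln_exp_sum (l : R) : (0 < m)%N -> (0 < n)%N ->
  l = Num.sqrt (m + n)%:R / (b * Num.sqrt (m * n)%:R) ->
  expect q (fun x => ln (exp_sum l (noise x))) <= 38 * (m + n)%:R.
Proof.
move=> m_gt0 n_gt0 lE.
have S_gt0 x := exp_sum_gt0 l (noise x).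
apply: le_trans (jensen_ln q_ge0 q_sum1 S_gt0) _.
rewrite -[X in _ <= X]expRK.
have ES : expect q (fun x => exp_sum l (noise x)) <= expR (38 * (m + n)%:R).
  rewrite /exp_sum expect_sum.
  under eq_bigr do rewrite expect_sum.
  have lb : 32 * (l * b) ^+ 2 * (m * n)%:R = 32 * (m + n)%:R.
    have -> : l * b = Num.sqrt (m + n)%:R / Num.sqrt (m * n)%:R.
      rewrite lE; field; rewrite (gt_eqF b_gt0) /= gt_eqF //.
      by rewrite sqrtr_gt0 ltr0n muln_gt0 m_gt0.
    rewrite exprMn exprVn !sqr_sqrtr // mulrA mulfVK //.
    by rewrite pnatr_eq0 -lt0n muln_gt0 m_gt0.
  apply: le_trans (_ : \sum_(z : lattice m | in_ball R z)
     \sum_(w : lattice n | in_ball R w) expR (32 * (m + n)%:R) <= _).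
    apply: ler_sum => z' zb'; apply: ler_sum => w' wb'.
    by rewrite -lb; apply: expect_exp_form.
  have -> : \sum_(z : lattice m | in_ball R z)
     \sum_(w : lattice n | in_ball R w) expR (32 * (m + n)%:R) =
     (\sum_(z : lattice m | in_ball R z) 1) * ((\sum_(w : lattice n | in_ball R w) 1)
     * expR (32 * (m + n)%:R)) :> R.
    rewrite mulr_suml; apply: eq_bigr => z' _; rewrite mul1r mulr_suml.
    by apply: eq_bigr => w' _; rewrite mul1r.
  have -> : 38 * (m + n)%:R = 6 * m%:R + (6 * n%:R + 32 * (m + n)%:R) :> R.
    by rewrite natrD; ring.
  rewrite !expRD; apply: ler_pM; rewrite ?card_ball //.
  - by rewrite sumr_ge0.
  - by rewrite mulr_ge0 ?expR_ge0 ?sumr_ge0.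
  - by rewrite ler_pM2r ?expR_gt0 // card_ball.
by rewrite ler_ln ?posrE ?expR_gt0 ?expect_gt0.
Qed.

End NoiseMatrix.

(** * The estimator *)

Definition mx_of m n (x : {ffun 'I_m * 'I_n -> bool}) : 'M[bool]_(m, n) :=
  \matrix_(i, j) x (i, j).

Lemma mx_of_bij m n : bijective (@mx_of m n).
Proof.
exists (fun A : 'M[bool]_(m, n) => [ffun p => A p.1 p.2]) => [x|A].
  by apply/ffunP => -[i j]; rewrite ffunE mxE.
by apply/matrixP => i j; rewrite mxE ffunE.
Qed.

Definition entry_law (R : realType) m n (rho : R) (M : 'M[R]_(m, n))
    (p : 'I_m * 'I_n) (a : bool) : R :=
  entry_pmf rho (M p.1 p.2) true a + entry_pmf rho (M p.1 p.2) false a.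

Lemma joint_pmf_marginal (R : realType) m n (rho : R) (M : 'M[R]_(m, n)) x :
  \sum_(Y : 'M[bool]_(m, n)) joint_pmf rho M (Y, mx_of x) =
  weight (entry_law rho M) x.
Proof.
rewrite (reindex (@mx_of m n)) /=; last exact/onW_bij/mx_of_bij.
rewrite /weight /entry_law.
under [RHS]eq_bigr => p _ do
  rewrite -(big_bool _ (fun y => entry_pmf rho (M p.1 p.2) y (x p))).
rewrite bigA_distr_bigA; apply: eq_bigr => y _.
rewrite /joint_pmf pair_bigA; apply: eq_bigr => -[i j] _ /=.
by rewrite !mxE.
Qed.

Lemma joint_pmf_ge0 (R : realType) m n (rho : R) (M : 'M[R]_(m, n)) w :
  (forall i j, 0 <= M i j <= 1) -> 0 <= rho < 1 -> 0 <= joint_pmf rho M w.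
Proof.
move=> M01 /andP[r0 r1]; apply: prodr_ge0 => i _; apply: prodr_ge0 => j _.
have /andP[M0 M1] := M01 i j.
rewrite /entry_pmf; case: (w.1 i j); case: (w.2 i j) => //.
- by rewrite mulr_ge0 ?subr_ge0 // ltW.
- by rewrite mulr_ge0.
- by rewrite subr_ge0.
Qed.

(** The target event involves [Y] through the number of ones, while the concentration bounds concern
    [A] alone; an event in [A] that forces the target for every [Y] transfers its probability. *)
Lemma marginal_le_joint (R : realType) m n (rho : R) (M : 'M[R]_(m, n))
    (P : pred {ffun 'I_m * 'I_n -> bool})
    (Q : pred ('M[bool]_(m, n) * 'M[bool]_(m, n))) :
  (forall i j, 0 <= M i j <= 1) -> 0 <= rho < 1 ->
  (forall Y x, P x -> Q (Y, mx_of x)) ->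
  \sum_(x | P x) weight (entry_law rho M) x <= \sum_(w | Q w) joint_pmf rho M w.
Proof.
move=> M01 rho01 PQ.
under eq_bigr do rewrite -joint_pmf_marginal.
rewrite exchange_big /= big_mkcond /=.
rewrite [X in _ <= X](_ : _ = \sum_Y \sum_x
    if Q (Y, mx_of x) then joint_pmf rho M (Y, mx_of x) else 0).
  apply: ler_sum => Y _; rewrite big_mkcond; apply: ler_sum => x _.
  case: ifP => [/PQ ->//|_]; case: ifP => // _; exact: joint_pmf_ge0.
rewrite big_mkcond [RHS](eq_bigr (fun Y => \sum_A
  if Q (Y, A) then joint_pmf rho M (Y, A) else 0)) => [|Y _].
  by rewrite pair_bigA; apply: eq_bigr => -[Y A].
by rewrite [RHS](reindex (@mx_of m n)) //; exact/onW_bij/mx_of_bij.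
Qed.

(** * Mean and fluctuation of the worst-case correlation with the noise *)

Section Concentration.
Variables (R : realType) (m n : nat) (M : 'M[R]_(m, n)) (t rho : R).
Hypotheses (m_gt0 : (0 < m)%N) (n_gt0 : (0 < n)%N).
Hypothesis M01 : forall i j, 0 <= M i j <= 1.
Hypothesis M_nuc : nucnorm M <= t.
Hypothesis rho01 : 0 <= rho < 1.
Variable Xhat : 'M[bool]_(m, n) -> 'M[R]_(m, n).
Hypothesis Xhat_min : forall A, shiftmc_minimizer rho t A (Xhat A).

Local Notation q := (entry_law rho M).
Local Notation b := (1 - rho)^-1.
Local Notation N x := (noise q b x).

Lemma inv_keep_gt0 : 0 < b.
Proof. by rewrite invr_gt0 subr_gt0; case/andP: rho01. Qed.

Lemma law_trueE p : q p true = M p.1 p.2 * (1 - rho).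
Proof. by rewrite /entry_law addr0. Qed.

Lemma law_ge0 p a : 0 <= q p a.
Proof.
have /andP[M0 M1] := M01 p.1 p.2; have /andP[r0 r1] := rho01.
rewrite /entry_law; case: a => /=; first by rewrite addr0 mulr_ge0 // subr_ge0 ltW.
by rewrite addr_ge0 ?mulr_ge0 ?subr_ge0.
Qed.

Lemma law_sum1 p : q p true + q p false = 1.
Proof. by rewrite /entry_law /=; ring. Qed.

Lemma noiseE x i j : N x i j = b * (x (i, j))%:R - M i j.
Proof.
rewrite mxE law_trueE /=; field.
by rewrite subr_eq0 eq_sym lt_eqF //; case/andP: rho01.
Qed.

(** [x] drives the noise and [y] selects an output of the estimator. Separating them lets the output
    be held fixed while the noise varies; the actual estimator is the diagonal [y = x]. *)
Definition correlation x y : R :=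
  \sum_i \sum_j N x i j * (Xhat (mx_of y) - M) i j.

Definition worst x := [arg max_(y > x) correlation x y]%O.

(* The supremum over the feasible set may be replaced by a maximum over the
   finitely many matrices that the estimator can output. *)
Definition deviation x : R := correlation x (worst x).

Lemma correlation_le x y : correlation x y <= deviation x.
Proof. by rewrite /deviation /worst; case: arg_maxP => // z _; apply. Qed.

Lemma Xhat01 A i j : 0 <= Xhat A i j <= 1.
Proof. by case: (Xhat_min A) => -[]. Qed.

(** Keep the maximiser for [x] as a competitor after the flip: one noise entry moves by [b], against
    an entry of [Xhat - M] in [[-1, 1]]. *)
Lemma deviation_bounded_differences : bounded_differences (fun=> b) deviation.
Proof.
have step x p : deviation x - deviation (flip p x) <= b.
  apply: le_trans (lerB (lexx _) (correlation_le _ (worst x))) _.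
  rewrite /deviation /correlation noise_linear_flip.
  apply: le_trans (ler_norm _) _.
  rewrite 2!normrM normrX normrN1 expr1n mulr1 (gtr0_norm inv_keep_gt0).
  rewrite ler_piMr ?(ltW inv_keep_gt0) // !mxE.
  have := Xhat01 (mx_of (worst x)) p.1 p.2; have := M01 p.1 p.2.
  by rewrite ler_norml => /andP[? ?] /andP[? ?]; apply/andP; split; lra.
move=> p x; rewrite ler_norml step andbT lerNl opprB.
by have := step (flip p x) p; rewrite flipK.
Qed.

(* The value of [l] balancing the two terms of the log-sum-exp bound. *)
Let l : R := Num.sqrt (m + n)%:R / (b * Num.sqrt (m * n)%:R).

Lemma sqrt_gt0 k : (0 < k)%N -> 0 < Num.sqrt (k%:R : R).
Proof. by rewrite sqrtr_gt0 ltr0n. Qed.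

Lemma mn_gt0 : (0 < m * n)%N. Proof. by rewrite muln_gt0 m_gt0. Qed.
Lemma addmn_gt0 : (0 < m + n)%N. Proof. by rewrite addn_gt0 m_gt0. Qed.

Lemma net_scale_gt0 : 0 < l.
Proof.
by rewrite /l divr_gt0 ?mulr_gt0 ?sqrt_gt0 ?inv_keep_gt0 ?mn_gt0 ?addmn_gt0.
Qed.

Lemma trace_mulE (X Z : 'M[R]_(m, n)) :
  \tr (X^T *m Z) = \sum_i \sum_j Z i j * X i j.
Proof.
rewrite exchange_big; apply: eq_bigr => j _; rewrite mxE.
by apply: eq_bigr => i _; rewrite mxE mulrC.
Qed.

(** Trace duality is applied to the output with [N] and to [M] with [- N]; both nuclear norms are at
    most [t]. *)
Lemma deviation_le_ln x :
  deviation x <= 2 * t / (l * Num.sqrt (m * n)%:R) * ln (exp_sum l (N x)).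
Proof.
set k := ln (exp_sum l (N x)) / (l * Num.sqrt (m * n)%:R).
have bil u v := @bilinear_le_exp_sum R m n l (N x) u v m_gt0 n_gt0 net_scale_gt0.
(* Zero vectors in the bilinear bound; the sign allows the nuclear norms to be replaced by [t]. *)
have k_ge0 : 0 <= k.
  have := bil 0 0; rewrite !mul0mx !mxE; apply; exact: ler01.
have bilN (u : 'rV[R]_m) (v : 'rV[R]_n) :
   (u *m u^T) 0 0 <= 1 -> (v *m v^T) 0 0 <= 1 -> (u *m (- N x) *m v^T) 0 0 <= k.
  move=> uu vv; rewrite mulmxN -mulNmx; apply: bil => //.
  by rewrite linearN /= mulmxN mulNmx opprK.
have tX := trace_duality bil (Xhat (mx_of (worst x))).
have tM := trace_duality bilN M.
have [[nX _] _] := Xhat_min (mx_of (worst x)).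
have -> : deviation x = \tr ((Xhat (mx_of (worst x)))^T *m N x) + \tr (M^T *m - N x).
  rewrite !trace_mulE -big_split; apply: eq_bigr => i _.
  by rewrite -big_split; apply: eq_bigr => j _; rewrite !mxE /=; ring.
have -> : 2 * t / (l * Num.sqrt (m * n)%:R) * ln (exp_sum l (N x)) = k * t + k * t.
  by rewrite /k; ring.
apply: lerD; [apply: le_trans tX _|apply: le_trans tM _]; exact: ler_wpM2l.
Qed.

Lemma t_ge0 : 0 <= t.
Proof. exact: le_trans (nucnorm_ge0 M) M_nuc. Qed.

Lemma expect_deviation :
  expect q deviation <= 76 * t * b * Num.sqrt (m + n)%:R.
Proof.
apply: le_trans (le_expect law_ge0 deviation_le_ln) _.
rewrite expectZ.
have c0 : 0 <= 2 * t / (l * Num.sqrt (m * n)%:R).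
  apply: divr_ge0; apply: mulr_ge0 => //; [exact: t_ge0|exact: ltW net_scale_gt0|exact: sqrtr_ge0].
have lE : l = Num.sqrt (m + n)%:R / (b * Num.sqrt (m * n)%:R) by [].
have := expect_ln_exp_sum law_ge0 law_sum1 inv_keep_gt0 m_gt0 n_gt0 lE.
move/(ler_wpM2l c0)/le_trans; apply.
(* Writing [m + n] as a square lets [field] cancel one root against [l]; the next line undoes the
   rewriting under the radicals. *)
have -> : (m + n)%:R = Num.sqrt (m + n)%:R ^+ 2 :> R by rewrite sqr_sqrtr.
rewrite [Num.sqrt (Num.sqrt _ ^+ 2)]sqrtr_sqr ger0_norm ?sqrtr_ge0 //.
have s1 : Num.sqrt (m + n)%:R != 0 :> R by rewrite gt_eqF // sqrt_gt0 // addmn_gt0.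
have s2 : Num.sqrt (m * n)%:R != 0 :> R by rewrite gt_eqF // sqrt_gt0 // mn_gt0.
have b0 : 1 - rho != 0 by have := inv_keep_gt0; rewrite invr_gt0 => /gt_eqF ->.
rewrite le_eqVlt; apply/orP; left; apply/eqP; rewrite /l.
by field; rewrite b0 s1 s2.
Qed.

Lemma pu_lossE u a : pu_loss rho u a = u ^+ 2 - 2 * (b * a%:R) * u + b * a%:R.
Proof.
have b0 : 1 - rho != 0 by have := inv_keep_gt0; rewrite invr_gt0 => /gt_eqF ->.
by rewrite /pu_loss; case: a => /=; [field | ring].
Qed.

(* The shifted loss is the squared loss against the unbiased surrogate
   [A / (1 - rho)] of [M], so optimality against the feasible point [M] bounds
   the squared error by the correlation with the noise. *)
Lemma sqr_error_le_correlation x :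
  \sum_i \sum_j (M i j - Xhat (mx_of x) i j) ^+ 2 <= 2 * correlation x x.
Proof.
have [_ /(_ M (conj M_nuc M01))] := Xhat_min (mx_of x).
rewrite -subr_ge0 /pu_obj -sumrB => opt.
rewrite -subr_ge0; apply: le_trans opt _.
rewrite /correlation mulr_sumr -sumrB; apply: ler_sum => i _.
rewrite -sumrB mulr_sumr -sumrB; apply: ler_sum => j _.
by rewrite !pu_lossE noiseE !mxE le_eqVlt; apply/orP; left; apply/eqP; ring.
Qed.

Lemma sqr_error_bound x s :
  deviation x < expect q deviation + s ->
  \sum_i \sum_j (M i j - Xhat (mx_of x) i j) ^+ 2 <=
  152 * t * b * (Num.sqrt n%:R + Num.sqrt m%:R) + 2 * s.
Proof.
move=> dev; apply: le_trans (sqr_error_le_correlation x) _.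
have c := correlation_le x x.
have e := expect_deviation.
have sq : Num.sqrt (m + n)%:R <= Num.sqrt n%:R + Num.sqrt m%:R :> R.
  rewrite -(@ler_pXn2r _ 2) ?nnegrE ?addr_ge0 ?sqrtr_ge0 // sqrrD !sqr_sqrtr //.
  rewrite natrD; have := mulr_ge0 (sqrtr_ge0 (n%:R : R)) (sqrtr_ge0 (m%:R : R)); lra.
have : 76 * t * b * Num.sqrt (m + n)%:R <= 76 * t * b * (Num.sqrt n%:R + Num.sqrt m%:R).
  by rewrite ler_wpM2l // !mulr_ge0 ?t_ge0 // ltW ?inv_keep_gt0.
lra.
Qed.

(** The squared differences sum to [D = m n b^2], and the threshold solves [s^2 / (8 D) = L]. *)
Lemma deviation_tail L : 0 <= L ->
  \sum_(x | expect q deviation + b * Num.sqrt (8 * (m * n)%:R * L) <= deviation x)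
    weight q x <= expR (- L).
Proof.
move=> L0; set s := b * _.
have D0 : 0 < (m * n)%:R * b ^+ 2.
  by rewrite mulr_gt0 ?ltr0n ?mn_gt0 // exprn_gt0 // inv_keep_gt0.
have s0 : 0 <= s by rewrite mulr_ge0 ?sqrtr_ge0 // ltW // inv_keep_gt0.
apply: le_trans (mcdiarmid_tail law_ge0 law_sum1 D0 s0 _) _.
  exists (fun=> b); first exact: deviation_bounded_differences.
  by rewrite sumr_const card_prod !card_ord mulr_natl.
rewrite ler_expR lerN2 /s exprMn sqr_sqrtr ?mulr_ge0 //.
rewrite le_eqVlt; apply/orP; left; apply/eqP; field.
rewrite !pnatr_eq0 -!lt0n m_gt0 n_gt0 !andbT.
by have := inv_keep_gt0; rewrite invr_gt0 => /gt_eqF ->.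
Qed.

End Concentration.

Theorem theorem4 (R : realType) :
  exists C : R,
  forall (m n : nat) (M : 'M[R]_(m, n)) (t rho delta : R),
    (0 < m)%N -> (0 < n)%N ->
    (forall i j, 0 <= M i j <= 1) -> nucnorm M <= t ->
    0 <= rho < 1 -> 0 < delta < 1 ->
    forall Xhat : 'M[bool]_(m, n) -> 'M[R]_(m, n),
      (forall A, shiftmc_minimizer rho t A (Xhat A)) ->
      1 - delta <=
      \sum_(w : 'M[bool]_(m, n) * 'M[bool]_(m, n) |
              (m * n)%:R^-1 * (\sum_(i < m) \sum_(j < n) (M i j - Xhat w.2 i j) ^+ 2)
              <= 6 * Num.sqrt (ln (2 / delta)) / (Num.sqrt (m * n)%:R * (1 - rho))
                 + 2 * C * t * (Num.sqrt n%:R + Num.sqrt m%:R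
                                + Num.sqrt (Num.sqrt (nones w.1)%:R))
                   / ((1 - rho) * (m * n)%:R))
        joint_pmf rho M w.
Proof.
(* Twice 76 is the constant 152 of [sqr_error_bound]. *)
exists 76 => m n M t rho delta m_gt0 n_gt0 M01 M_nuc rho01 /andP[d0 d1] Xhat Xmin.
pose L := ln (2 / delta).
have L_gt0 : 0 < L by rewrite ln_gt0 // ltr_pdivlMr // mul1r; lra.
pose s := (1 - rho)^-1 * Num.sqrt (8 * (m * n)%:R * L).
pose dev := deviation M rho Xhat.
pose q := entry_law rho M.
have tail := deviation_tail m_gt0 n_gt0 M01 rho01 Xmin (ltW L_gt0).
have good : 1 - delta <= \sum_(x | ~~ (expect q dev + s <= dev x)) weight q x.
  have := weight_sum1 (law_sum1 M rho).
  rewrite (bigID (fun x => expect q dev + s <= dev x)) /= => tot.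
  (* In fact [expR (- L) = delta / 2]. *)
  have : expR (- L) <= delta.
    by rewrite /L expRN lnK ?posrE ?divr_gt0 // invf_div ler_pdivrMr //; lra.
  move: tail tot; rewrite -/q -/dev -/s; lra.
apply: le_trans good (marginal_le_joint M01 rho01 _) => Y x; rewrite -ltNge => small.
have bnd := sqr_error_bound m_gt0 n_gt0 M01 M_nuc rho01 Xmin small.
have r0 : 0 < 1 - rho by rewrite subr_gt0; case/andP: rho01.
have mn0 : 0 < (m * n)%:R :> R by rewrite ltr0n muln_gt0 m_gt0.
have t0 := t_ge0 M_nuc.
have sL0 := sqrtr_ge0 L.
have smn0 : 0 < Num.sqrt (m * n)%:R :> R by rewrite sqrtr_gt0.
rewrite mulrC ler_pdivrMr //; apply: le_trans bnd _.
rewrite [X in _ <= X]mulrDl [X in X <= _]addrC; apply: lerD.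
  have -> : 6 * Num.sqrt (ln (2 / delta)) / (Num.sqrt (m * n)%:R * (1 - rho)) * (m * n)%:R =
      (1 - rho)^-1 * (Num.sqrt (m * n)%:R * (6 * Num.sqrt L)).
    rewrite -[in X in _ * X = _](sqr_sqrtr (ltW mn0)) /L; field.
    by rewrite !gt_eqF.
  rewrite /s mulrCA ler_pM2l ?invr_gt0 //.
  have -> : 8 * (m * n)%:R * L = (m * n)%:R * (8 * L) by ring.
  rewrite (sqrtrM _ (ltW mn0)) mulrCA (ler_pM2l smn0).
  rewrite (sqrtrM L (ler0n R 8)) mulrA ler_wpM2r //.
  (* The constant 6 comes from [2 sqrt 8 <= 6], that is [32 <= 36]. *)
  rewrite -(@ler_pXn2r _ 2) ?nnegrE ?mulr_ge0 ?sqrtr_ge0 // exprMn sqr_sqrtr //; lra.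
have -> : 2 * 76 * t * (Num.sqrt n%:R + Num.sqrt m%:R + Num.sqrt (Num.sqrt (nones Y)%:R)) /
   ((1 - rho) * (m * n)%:R) * (m * n)%:R =
   152 * t * (1 - rho)^-1 * (Num.sqrt n%:R + Num.sqrt m%:R + Num.sqrt (Num.sqrt (nones Y)%:R)).
  by field; rewrite (gt_eqF r0) !pnatr_eq0 -!lt0n m_gt0 n_gt0.
by rewrite ler_wpM2l ?mulr_ge0 ?invr_ge0 ?(ltW r0) // lerDl sqrtr_ge0.
Qed.
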